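(* Let $p$ be an odd prime, $\zeta=e^{2\pi i/p}$, and $R_p=\{0,2,3,\dots,p-2\}$. For $\epsilon,\delta\in\{\pm1\}$ let $$A_{\epsilon\delta}=\left\{a\in R_p:\ \left(\frac{a^2-1}{p}\right)=\epsilon,\ \left(\frac{2(a+1)}{p}\right)=\delta\right\},\qquad g_{\epsilon\delta}=\sum_{a\in A_{\epsilon\delta}}\zeta^a.$$ Then for all odd primes $p$ and all $\epsilon,\delta\in\{\pm1\}$, $|g_{\epsilon\delta}|\le \sqrt p+5/4$.
   Context: $\left(\frac{\cdot}{p}\right)$ denotes the Legendre symbol. *)

(* Defs.v *)
From Stdlib Require Import Reals ZArith List Znumtheory.
From Coquelicot Require Import Coquelicot.
Import ListNotations.
Open Scope R_scope.

Definition legendre (a p : Z) : Z :=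
  if Z.eqb (a mod p) 0 then 0%Z
  else if existsb (fun x => Z.eqb ((x * x - a) mod p) 0)
                  (map Z.of_nat (seq 0 (Z.to_nat p)))
       then 1%Z else (-1)%Z.

Definition Rp (p : nat) : list nat := 0%nat :: seq 2 (p - 3).

Definition Aed (p : nat) (eps delta : Z) : list nat :=
  filter (fun a => let az := Z.of_nat a in
            andb (Z.eqb (legendre (az * az - 1) (Z.of_nat p)) eps)
                 (Z.eqb (legendre (2 * (az + 1)) (Z.of_nat p)) delta))
         (Rp p).

Definition zeta (p : nat) : C := (cos (2 * PI / INR p), sin (2 * PI / INR p)).

Definition ged (p : nat) (eps delta : Z) : C :=
  fold_right Cplus (RtoC 0) (map (fun a => Cpow (zeta p) a) (Aed p eps delta)).

(* Main.v *)
(** Write psi(a) = zeta^a on F_p and chi for the quadratic character.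
    Expanding the indicator (1 + eps chi(a^2-1)) (1 + delta chi(2(a+1))) / 4 turns 4 g into the
    sum of a term of modulus at most 2, two shifted Gauss sums of modulus at most sqrt p + 1, and
    K = sum_a chi(a^2-1) psi(a).  Since a^2-1 is a square y^2 exactly when x + 1/(4x) = a has the
    solution x = (y+a)/2, K is the Kloosterman sum of x + c/x with c = 1/4, and everything rests
    on Weil's bound |K| <= 2 sqrt p.

    For f(x) = x + c/x let S_n be the Kloosterman sum over the field with q = p^n elements.
    Sorting pairs (x,y) in F_q^2 and conjugate pairs (x, x^q) in F_(q^2) by their sum and product
    gives S_(2n) = 2q - S_n^2, so |S_n| > 2 sqrt q would make |S_(2^k n)| / p^(2^k n / 2) unbounded.
    This contradicts |S_(2n)| <= 7 p q, which is proved by Stepanov's method: for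
    h = sum_(i<n) f^(p^i), the points of F_(q^2) with Tr f(x) = t satisfy x^(q^2) = x and
    h(x) = (t - h(x))^q.  A nontrivial relation sum C x^(a q + b) h^j = 0 therefore becomes, after
    extracting q-th roots, a nonzero rational function of degree q^2/p + O(q) vanishing at them. *)

From HB Require Import structures.
From mathcomp Require Import all_boot all_order all_algebra all_field.
From mathcomp Require Import complex ssrZ zify ring lra Rstruct.
Set Implicit Arguments. Unset Strict Implicit. Unset Printing Implicit Defensive.
Import Order.TTheory GRing.Theory Num.Theory.
Local Open Scope ring_scope.

(** * Finite fields *)

Section PolynomialFacts.
Variable F : fieldType.

(** The coefficient matrix has more rows than columns, so its left kernel is nonzero. *)
Lemma dependent_polys (I : finType) (G : I -> {poly F}) (N : nat) :
    (forall i, size (G i) <= N)%N -> (N < #|I|)%N ->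
  exists2 c : I -> F, (exists i, c i != 0) & \sum_i c i *: G i = 0.
Proof.
move=> sizeG ltN.
pose A : 'M[F]_(#|I|, N) := \matrix_(i, j) (G (enum_val i))`_j.
have: kermx A != 0.
  rewrite kermx_eq0 /row_free neq_ltn; apply/orP; left.
  exact: leq_ltn_trans (rank_leq_col A) ltN.
case/rowV0Pn=> v /sub_kermxP vA0 /rV0Pn[i0 vi0].
exists (fun i => v 0 (enum_rank i)); first by exists (enum_val i0); rewrite enum_valK.
apply/polyP=> j; rewrite coef0 coef_sum.
have [ltjN|leNj] := ltnP j N; last first.
  by apply: big1 => i _; rewrite coefZ nth_default ?mulr0 // (leq_trans (sizeG i)).
have /rowP/(_ (Ordinal ltjN)) := vA0; rewrite !mxE => vAj.
rewrite -[RHS]vAj (reindex_onto enum_rank enum_val) /=; last by move=> i _; rewrite enum_valK.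
apply: eq_big => [i|i _]; first by rewrite enum_rankK eqxx.
by rewrite coefZ mxE enum_rankK.
Qed.

(** Among the members with nonzero coefficient, the one of largest degree contributes a leading term
    that no other member can cancel. *)
Lemma independent_polys (I : finType) (G : I -> {poly F}) (c : I -> F) :
    (forall i, G i != 0) -> injective (fun i => size (G i)) ->
  \sum_i c i *: G i = 0 -> forall i, c i = 0.
Proof.
move=> G0 injG sum0 i; apply/eqP; apply: contraT => ci0.
have [j cj0 maxj] := @arg_maxnP I i (fun i => c i != 0) (fun i => size (G i)) ci0.
have /(congr1 (fun q : {poly F} => q`_(size (G j)).-1)) := sum0.
rewrite coef0 coef_sum (bigD1 j) //= big1 ?addr0 => [|k kj].
  rewrite coefZ => /eqP; rewrite mulf_eq0 (negPf cj0) /=.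
  by rewrite -lead_coefE lead_coef_eq0 (negPf (G0 j)).
rewrite coefZ; have [->|ck0] := eqVneq (c k) 0; first by rewrite mul0r.
have lekj : (size (G k) <= size (G j))%N := maxj k ck0.
rewrite nth_default ?mulr0 // -ltnS prednK ?size_poly_gt0 // ltn_neqAle lekj andbT.
by apply: contra kj => /eqP/injG->.
Qed.

End PolynomialFacts.

(** * Frobenius, traces and subfields inside one finite field *)

Section FrobeniusFixedPoints.
Variables (p : nat) (L : finFieldType).

(** The proof of [p \in [pchar L]] is an argument so that the ring morphism structures below can be
    attached to [frob pL n]. *)
Definition frob of p \in [pchar L] := fun (n : nat) (x : L) => x ^+ (p ^ n).

Hypothesis pL : p \in [pchar L].
Let p_pr : prime p := pcharf_prime pL.

Fact frob_is_nmod_morphism n : nmod_morphism (frob pL n).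
Proof.
split=> [|x y]; first by rewrite /frob expr0n expn_eq0 -[p == _]negbK -lt0n prime_gt0.
rewrite /frob exprDn_pchar // pnatX pnatE //; apply/orP; left.
by [].
Qed.

Fact frob_is_monoid_morphism n : monoid_morphism (frob pL n).
Proof. by split=> [|x y]; rewrite /frob ?expr1n ?exprMn. Qed.

HB.instance Definition _ n :=
  GRing.isNmodMorphism.Build L L (frob pL n) (frob_is_nmod_morphism n).
HB.instance Definition _ n :=
  GRing.isMonoidMorphism.Build L L (frob pL n) (frob_is_monoid_morphism n).

Lemma frob_add m n x : frob pL (m + n) x = frob pL n (frob pL m x).
Proof. by rewrite /frob expnD exprM. Qed.

Lemma frob0 x : frob pL 0 x = x.
Proof. by rewrite /frob expn0 expr1. Qed.

Lemma frob_bij n : bijective (frob pL n).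
Proof. exact: injF_bij (fmorph_inj (frob pL n : {rmorphism L -> L})). Qed.

(** On [fixed n] this is the trace to the prime field; on the rest of [L] it is only an additive
    map. *)
Definition trace n x := \sum_(i < n) frob pL i x.

Fact trace_is_nmod_morphism n : nmod_morphism (trace n).
Proof.
split=> [|x y]; rewrite /trace; first by apply: big1 => i _; rewrite rmorph0.
by rewrite -big_split; apply: eq_bigr => i _; rewrite rmorphD.
Qed.
HB.instance Definition _ n :=
  GRing.isNmodMorphism.Build L L (trace n) (trace_is_nmod_morphism n).

Lemma trace_double n x : trace (n + n) x = trace n (x + frob pL n x).
Proof.
rewrite raddfD /trace big_split_ord /=; congr (_ + _).
by apply: eq_bigr => i _; rewrite frob_add.
Qed.

Lemma frob_trace n m x : frob pL m (trace n x) = trace n (frob pL m x).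
Proof.
rewrite /trace rmorph_sum; apply: eq_bigr => i _ /=.
by rewrite -!frob_add addnC.
Qed.

Lemma trace_fixed n x : frob pL n x = x -> frob pL 1 (trace n x) = trace n x.
Proof.
move=> fx; rewrite frob_trace; case: n fx => [|n] fx; first by rewrite /trace !big_ord0.
rewrite /trace big_ord_recr big_ord_recl /= -frob_add add1n fx frob0 addrC; congr (_ + _).
by apply: eq_bigr => i _; rewrite -frob_add.
Qed.

(** When [L] has p^m elements and n divides m, this is the subfield with p^n elements. Treating
    subfields as subsets of [L] keeps all levels in one type. *)
Definition fixed n := [set x | frob pL n x == x].

Lemma fixedP n x : reflect (frob pL n x = x) (x \in fixed n).
Proof. by rewrite inE; apply: eqP. Qed.

Lemma frob_muln_fixed n k x : x \in fixed n -> frob pL (n * k) x = x.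
Proof.
move/fixedP=> fx; elim: k => [|k IH]; first by rewrite muln0 frob0.
by rewrite mulnS frob_add fx.
Qed.

Lemma size_XnsubX (R : nzRingType) N : (1 < N)%N -> size ('X^N - 'X : {poly R}) = N.+1.
Proof. by move=> N1; rewrite size_polyDl size_polyXn // size_polyN size_polyX. Qed.

(** X^(p^n) - X divides X^(p^m) - X, which is the product of all X - a with a in [L]; hence it
    splits into p^n distinct linear factors. *)
Lemma card_fixed n m : (0 < n)%N -> (n %| m)%N -> #|L| = (p ^ m)%N -> #|fixed n| = (p ^ n)%N.
Proof.
move=> n0 /dvdnP[k ->] cardL.
pose P N : {poly L} := 'X^(p ^ N) - 'X.
have pn1 : (1 < p ^ n)%N by rewrite -(exp1n n) ltn_exp2r ?prime_gt1.
have: P n %| P (k * n)%N.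
  elim: k {cardL} => [|k IH]; first by rewrite mul0n /P expn0 expr1 subrr dvdp0.
  (* Raising to the power p^(kn) is additive, so the two copies of X^(p^(kn)) cancel. *)
  have -> : P (k.+1 * n)%N = P n ^+ (p ^ (k * n)) + P (k * n)%N.
    have pcharX : [pchar {poly L}].-nat (p ^ (k * n))%N.
      by rewrite pnatX pnatE //; apply/orP; left; rewrite (rmorph_pchar polyC).
    rewrite /P exprDn_pchar // exprNn_pchar //.
    by rewrite -exprM -expnD mulSn addrA subrK.
  by rewrite dvdp_addr // dvdp_exp // expn_gt0 prime_gt0.
rewrite /P -cardL finField_genPoly -big_enum /= => /dvdp_prod_XsubC[b].
set s := mask b _ => /= eqP.
have us : uniq s by rewrite mask_uniq // enum_uniq.
have <- : size s = (p ^ n)%N.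
  by apply: succn_inj; rewrite -(size_XnsubX L pn1) (eqp_size eqP) size_prod_XsubC.
rewrite -(card_uniqP us); apply: eq_card => x.
by rewrite inE -root_prod_XsubC -(eqp_root eqP) /root !hornerE subr_eq0.
Qed.

Lemma fixed0 n : 0 \in fixed n. Proof. by apply/fixedP; rewrite rmorph0. Qed.
Lemma fixedD n : {in fixed n &, forall x y, x + y \in fixed n}.
Proof. by move=> x y /fixedP fx /fixedP fy; apply/fixedP; rewrite rmorphD /= fx fy. Qed.
Lemma fixedB n : {in fixed n &, forall x y, x - y \in fixed n}.
Proof. by move=> x y /fixedP fx /fixedP fy; apply/fixedP; rewrite rmorphB /= fx fy. Qed.
Lemma fixedM n : {in fixed n &, forall x y, x * y \in fixed n}.
Proof. by move=> x y /fixedP fx /fixedP fy; apply/fixedP; rewrite rmorphM /= fx fy. Qed.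
Lemma fixedV n : {in fixed n, forall x, x^-1 \in fixed n}.
Proof. by move=> x /fixedP fx; apply/fixedP; rewrite fmorphV /= fx. Qed.
Lemma fixed_trans m n : (m %| n)%N -> {subset fixed m <= fixed n}.
Proof. by move=> /dvdnP[k ->] x fx; apply/fixedP; rewrite mulnC frob_muln_fixed. Qed.

End FrobeniusFixedPoints.

(** * Split and conjugate pairs with prescribed sum and product *)

Section ConjugatePairs.
Variables (p : nat) (L : finFieldType) (pL : p \in [pchar L]).
Variables (n m : nat).
Hypotheses (n_gt0 : (0 < n)%N) (dvd2n : (n + n %| m)%N) (cardL : #|L| = (p ^ m)%N).
Local Notation f := (frob pL n).
Local Notation Fq := (fixed pL n).
Local Notation Fqq := (fixed pL (n + n)).

Let dvdn : (n %| m)%N.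
Proof. by apply: dvdn_trans dvd2n; rewrite addnn -muln2 dvdn_mulr. Qed.

Let split_pairs (s d : L) := [set x in Fq | x * (s - x) == d].
Let conj_pairs (s d : L) := [set x in Fqq | (x + f x == s) && (x * f x == d)].

Let regroup_split (V : nmodType) (G : L -> L -> V) :
  \sum_(x in Fq) \sum_(y in Fq) G (x + y) (x * y)
    = \sum_(s in Fq) \sum_(d in Fq) G s d *+ #|split_pairs s d|.
Proof.
transitivity (\sum_(x in Fq) \sum_(s in Fq) G s (x * (s - x))).
  apply: eq_bigr => x xF; rewrite (reindex_inj (addIr (- x))) /=.
  apply: eq_big => [s|s _]; last by rewrite addrC subrK.
  apply/idP/idP => [sF|sF]; last exact: fixedB.
  by rewrite -(subrK x s) fixedD.
rewrite exchange_big /=; apply: eq_bigr => s sF.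
rewrite (partition_big (fun x => x * (s - x)) (mem Fq)) /=; last first.
  by move=> x xF; rewrite fixedM ?fixedB.
apply: eq_bigr => d dF; rewrite -sumr_const.
by apply: eq_big => [x|x /andP[_ /eqP->]] //; rewrite !inE.
Qed.

Let frob_conj x : x \in Fqq -> f (f x) = x.
Proof. by rewrite -frob_add => /fixedP. Qed.

Let regroup_conj (V : nmodType) (G : L -> L -> V) :
  \sum_(x in Fqq) G (x + f x) (x * f x)
    = \sum_(s in Fq) \sum_(d in Fq) G s d *+ #|conj_pairs s d|.
Proof.
rewrite (partition_big (fun x => x + f x) (mem Fq)) /=; last first.
  by move=> x xE; apply/fixedP; rewrite rmorphD /= frob_conj // addrC.
apply: eq_bigr => s sF.
rewrite (partition_big (fun x => x * f x) (mem Fq)) /=; last first.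
  by move=> x /andP[xE _]; apply/fixedP; rewrite rmorphM /= frob_conj // mulrC.
apply: eq_bigr => d dF; rewrite -sumr_const.
apply: eq_big => [x|x /andP[/andP[_ /eqP-> /eqP->]]] //.
by rewrite !inE andbA.
Qed.

(* Both kinds of pairs consist of roots of X^2 - sX + d, and a root of both kinds is double. *)
Let card_pairs_le2 s d : (#|split_pairs s d| + #|conj_pairs s d| <= 2)%N.
Proof.
pose R := [set x | x * (s - x) == d].
have AR : split_pairs s d \subset R by apply/subsetP => x; rewrite !inE => /andP[].
have BR : conj_pairs s d \subset R.
  apply/subsetP => x; rewrite !inE => /and3P[_ /eqP<-].
  by rewrite [x + _]addrC addrK.
have Rx x : x \in R -> R \subset [set x; s - x].
  rewrite inE => /eqP dx; apply/subsetP => y; rewrite !inE -dx => /eqP eyx.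
  have /eqP : (y - x) * (y - (s - x)) = 0.
    by transitivity (x * (s - x) - y * (s - y)); [ring | rewrite eyx subrr].
  by rewrite mulf_eq0 !subr_eq0.
have UR : split_pairs s d :|: conj_pairs s d \subset R by rewrite subUset AR.
rewrite -cardsUI; have [->|[x]] := set_0Vmem (split_pairs s d :&: conj_pairs s d).
  rewrite cards0 addn0; apply: leq_trans (subset_leq_card UR) _.
  have [->|[x /Rx/subset_leq_card/leq_trans->//]] := set_0Vmem R; first by rewrite cards0.
  by rewrite cards2; case: eqP.
rewrite inE => /andP[xA xB]; have R1 : R \subset [set x].
  have sx : s - x = x.
    move: xA xB; rewrite !inE => /andP[/eqP fx _] /andP[_ /andP[/eqP<- _]].
    by rewrite fx addrK.
  by rewrite -[[set x]]setUid -{2}sx; apply: Rx; apply: (subsetP AR).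
have card1 (B : {set L}) : B \subset R -> (#|B| <= 1)%N.
  by move=> BsR; rewrite -(cards1 x) subset_leq_card // (subset_trans BsR).
apply: leq_trans (leq_add (card1 _ UR) (card1 _ _)) _ => //.
exact: subset_trans (subsetIl _ _) AR.
Qed.

(** There are q^2 pairs over F_q and q^2 elements of F_(q^2), together twice the number of (s, d).
    The upper bound 2 is therefore attained at every (s, d); [D] is the deficit. *)
Let card_pairs s d : s \in Fq -> d \in Fq -> (#|split_pairs s d| + #|conj_pairs s d|)%N = 2%N.
Proof.
pose D s d := (2 - (#|split_pairs s d| + #|conj_pairs s d|))%N.
suff: (\sum_(s in Fq) \sum_(d in Fq) D s d == 0)%N.
  move=> /[swap] sF /[swap] dF.
  rewrite sum_nat_eq0 => /forall_inP/(_ _ sF); rewrite sum_nat_eq0 => /forall_inP/(_ _ dF).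
  by rewrite subn_eq0 => ge2; apply/eqP; rewrite eqn_leq card_pairs_le2.
have total : (\sum_(s in Fq) \sum_(d in Fq) (#|split_pairs s d| + #|conj_pairs s d|)
               = 2 * (p ^ n * p ^ n))%N.
  have := regroup_conj (fun _ _ => 1%N); have := regroup_split (fun _ _ => 1%N).
  rewrite !sum1_card sum_nat_const !(card_fixed _ _ _ cardL) ?addn_gt0 ?n_gt0 // expnD.
  rewrite mul2n -addnn => eS eC; rewrite {1}eS eC -big_split; apply: eq_bigr => s' _ /=.
  by rewrite -big_split; apply: eq_bigr => d' _; rewrite !natn.
rewrite -(eqn_add2r (2 * (p ^ n * p ^ n))) -{1}total add0n -big_split /=.
under eq_bigr => s' _.
  rewrite -big_split /=; under eq_bigr => d' _ do rewrite subnK ?card_pairs_le2 //.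
  rewrite sum_nat_const; over.
by rewrite sum_nat_const (card_fixed _ _ _ cardL) //; apply/eqP; ring.
Qed.

Lemma sum_pairs_conj_pairs (V : nmodType) (G : L -> L -> V) :
  \sum_(x in Fq) \sum_(y in Fq) G (x + y) (x * y) + \sum_(x in Fqq) G (x + f x) (x * f x)
    = \sum_(s in Fq) \sum_(d in Fq) G s d *+ 2.
Proof.
rewrite regroup_split regroup_conj -big_split; apply: eq_bigr => s sF /=.
by rewrite -big_split; apply: eq_bigr => d dF /=; rewrite -mulrnDr card_pairs.
Qed.

End ConjugatePairs.

(** * Kloosterman sums *)

Section AdditiveCharacter.
Variables (p : nat) (L : finFieldType) (pL : p \in [pchar L]).
Variables (C : numFieldType) (zeta : C).
Hypothesis zeta_prim : p.-primitive_root zeta.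
Let p_pr : prime p := pcharf_prime pL.
Let p_gt0 : (0 < p)%N := prime_gt0 p_pr.

Let prime_field_seq := [seq i%:R : L | i <- iota 0 p].

Let uniq_prime_field_seq : uniq prime_field_seq.
Proof.
rewrite map_inj_in_uniq ?iota_uniq // => i j.
rewrite !mem_iota /= add0n => ip jp.
wlog leij : i j ip jp / (i <= j)%N.
  by move=> W; case: (leqP i j) => [|/ltnW] le e; [apply: W | apply/esym/W].
move/eqP; rewrite eq_sym -subr_eq0 -natrB // -(dvdn_pcharf pL) => dv.
apply/eqP; rewrite eqn_leq leij -subn_eq0 -leqn0 leqNgt; apply/negP => /dvdn_leq/(_ dv).
by rewrite leqNgt (leq_ltn_trans (leq_subr _ _)).
Qed.

(* Only meaningful on the prime field: elsewhere the index is [p] and the value is 1. *)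
Definition psi (u : L) : C := zeta ^+ index u prime_field_seq.

Lemma psi_nat k : psi k%:R = zeta ^+ k.
Proof.
rewrite /psi -(GRing.natr_mod_pchar pL); set i := (k %% p)%N.
have ip : (i < p)%N by rewrite ltn_mod.
have {1}-> : i%:R = nth 0 prime_field_seq i :> L by rewrite (nth_map 0%N) ?size_iota // nth_iota.
by rewrite index_uniq ?size_map ?size_iota // (prim_expr_mod zeta_prim).
Qed.

Section Cardinality.
Variable m : nat.
Hypothesis cardL : #|L| = (p ^ m)%N.

Lemma prime_fieldP u : reflect (exists2 k, (k < p)%N & u = k%:R) (u \in fixed pL 1).
Proof.
apply: (iffP idP) => [uF|[k _ ->]]; last by apply/fixedP; rewrite rmorph_nat.
have sub : {subset prime_field_seq <= fixed pL 1}.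
  by move=> _ /mapP[k _ ->]; apply/fixedP; rewrite rmorph_nat.
have [| |_ /(_ u)] := uniq_min_size uniq_prime_field_seq (s2 := enum (fixed pL 1)).
- by move=> v /sub; rewrite mem_enum.
- by rewrite -cardE (card_fixed pL (isT : 0 < 1)%N (dvd1n m) cardL) expn1 size_map size_iota.
rewrite mem_enum uF => /mapP[k]; rewrite mem_iota => /andP[_ kp] ->.
by exists k.
Qed.

Lemma psiD : {in fixed pL 1 &, {morph psi : u v / u + v >-> u * v}}.
Proof.
by move=> _ _ /prime_fieldP[i _ ->] /prime_fieldP[j _ ->]; rewrite -natrD !psi_nat exprD.
Qed.

Lemma psi0 : psi 0 = 1. Proof. by rewrite -[0]/(0%:R) psi_nat. Qed.

Lemma psi_eq1 u : u \in fixed pL 1 -> (psi u == 1) = (u == 0).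
Proof.
case/prime_fieldP=> k _ ->.
by rewrite psi_nat -(prim_order_dvd zeta_prim) (dvdn_pcharf pL).
Qed.

Lemma trace_prime_field n x : x \in fixed pL n -> trace pL n x \in fixed pL 1.
Proof. by move/fixedP/trace_fixed/fixedP. Qed.

Section Level.
Variable n : nat.
Hypotheses (n_gt0 : (0 < n)%N) (dvdn_m : (n %| m)%N).
Local Notation Fq := (fixed pL n).

(** The trace is a polynomial of degree p^(n-1), so it cannot vanish at all p^n elements of F_q. *)
Lemma trace_neq0 : exists2 z, z \in Fq & trace pL n z != 0.
Proof.
pose T : {poly L} := \sum_(i < n) 'X^(p ^ i).
have sizeT k : (size (\sum_(i < k) 'X^(p ^ i) : {poly L})%R <= p ^ k)%N.
  apply: leq_trans (size_sum _ _ _) _; apply/bigmax_leqP => i _.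
  by rewrite size_polyXn ltn_exp2l ?prime_gt1.
have T0 : T != 0.
  rewrite /T -(prednK n_gt0) big_ord_recr /= addrC -size_poly_gt0 size_polyDl size_polyXn //.
  by rewrite ltnS sizeT.
apply/exists_inP; apply: contraT; rewrite negb_exists_in => /forall_inP trace0.
have rootT : all (root T) (enum Fq).
  apply/allP => x; rewrite mem_enum => /trace0; rewrite negbK => /eqP trx0.
  by rewrite /root horner_sum -[X in _ == X]trx0; apply/eqP/eq_bigr => i _; rewrite hornerXn.
have := max_poly_roots T0 rootT (enum_uniq _).
by rewrite -cardE (card_fixed pL n_gt0 dvdn_m cardL) ltnNge sizeT.
Qed.

(** For u nonzero, translating s by z / u multiplies the sum by [psi] of the trace of z, which
    differs from 1 when that trace is nonzero. *)
Lemma sum_psi_trace u : u \in Fq ->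
  \sum_(s in Fq) psi (trace pL n (s * u)) = if u == 0 then (p ^ n)%:R else 0.
Proof.
move=> uF; case: eqVneq => [->|u0].
  under eq_bigr => s _ do rewrite mulr0 raddf0 psi0.
  by rewrite sumr_const (card_fixed pL n_gt0 dvdn_m cardL).
have [z zF trz] := trace_neq0; set S := \sum_(s in _) _.
have : S * psi (trace pL n z) = S.
  rewrite /S [RHS](reindex_inj (addIr (z / u))) mulr_suml /=.
  have zuF : z / u \in Fq by rewrite fixedM ?fixedV.
  apply: eq_big => [s|s sF].
    by apply/idP/idP => [sF|/fixedB/(_ zuF)]; [rewrite fixedD | rewrite addrK].
  by rewrite mulrDl divfK // raddfD psiD // trace_prime_field // fixedM.
move/eqP; rewrite -subr_eq0 -{2}[S]mulr1 -mulrBr mulf_eq0 => /orP[/eqP//|].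
by rewrite subr_eq0 psi_eq1 ?trace_prime_field // (negPf trz).
Qed.

End Level.

Section KloostermanSums.
Variable c : L.
Hypotheses (c_prime : c \in fixed pL 1) (c_neq0 : c != 0).

Definition kloosterman n :=
  \sum_(x in fixed pL n | x != 0) psi (trace pL n (x + c / x)).

(* f(x) + f(y) = s (1 + c / d) for f(x) = x + c / x, s = x + y and d = x y. *)
Lemma kloosterman_double n : (0 < n)%N -> (n + n %| m)%N ->
  kloosterman (n + n) = 2 * (p ^ n)%:R - kloosterman n ^+ 2.
Proof.
move=> n_gt0 dvd2n.
have dvdn : (n %| m)%N by apply: dvdn_trans dvd2n; rewrite addnn -muln2 dvdn_mulr.
have cF k : c \in fixed pL k by apply: fixed_trans c_prime.
(* The value 0 at d = 0 discards the pairs with a zero entry, which the Kloosterman sums exclude. *)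
pose G s d : C := if d == 0 then 0 else psi (trace pL n (s * (1 + c / d))).
have fE x y : x != 0 -> y != 0 -> (x + y) * (1 + c / (x * y)) = x + c / x + (y + c / y).
  by move=> x0 y0; field; rewrite x0 y0.
apply/eqP; rewrite -subr_eq addrC opprK; apply/eqP.
(* For fixed d the sum over s vanishes by orthogonality unless 1 + c / d = 0, so only d = -c
   survives and contributes 2q. *)
have <- : \sum_(s in fixed pL n) \sum_(d in fixed pL n) G s d *+ 2 = 2 * (p ^ n)%:R.
  rewrite exchange_big (bigD1 (- c)) /=; last by rewrite -sub0r fixedB ?fixed0.
  rewrite [X in _ + X]big1 => [|d /andP[dF dc]]; rewrite ?addr0 sumrMnl.
    rewrite -[LHS]mulr_natl; congr (_ * _); rewrite /G oppr_eq0 (negPf c_neq0).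
    by rewrite sum_psi_trace // invrN mulrN divff // subrr ?fixed0 ?eqxx.
  rewrite /G; case: eqVneq => [_|d0]; first by rewrite big1 // mul0rn.
  rewrite sum_psi_trace ?fixedD ?fixedM ?fixedV //; last by apply/fixedP; rewrite rmorph1.
  rewrite -[1](divff d0) -mulrDl mulf_eq0 invr_eq0 (negPf d0) orbF addr_eq0 (negPf dc).
  by rewrite mul0rn.
rewrite -(sum_pairs_conj_pairs pL n_gt0 dvd2n cardL); congr (_ + _).
  rewrite expr2 /kloosterman big_mkcondr big_distrlr /=; apply: eq_bigr => x xF.
  apply: eq_bigr => y yF; rewrite /G mulf_eq0.
  case: eqVneq => [|x0]; first by rewrite mul0r.
  case: eqVneq => [|y0]; first by rewrite mulr0.
  by rewrite fE // [in RHS]raddfD psiD // trace_prime_field // fixedD ?fixedM ?fixedV.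
rewrite /kloosterman big_mkcondr /=; apply: eq_bigr => x xE.
rewrite /G mulf_eq0 fmorph_eq0 orbb; case: eqVneq => [//|x0].
rewrite trace_double fE ?fmorph_eq0 // rmorphD fmorph_div /=.
by rewrite (fixedP pL _ _ (cF n)).
Qed.

End KloostermanSums.
End Cardinality.
End AdditiveCharacter.

(** With r = p^k and Q = p r, the left side bounds the sizes of the auxiliary polynomials and the
    right side is their number: r choices of a, r + 2 of b and p of j. *)
Lemma stepanov_count (p r : nat) : (0 < r)%N -> (1 < p)%N ->
  ((r.-1 * (p * r) + r.+1 + (p.-1 + p.-1) * r).+1 < r * r.+2 * p)%N.
Proof.
case: r p => [//|s] [|[|w]] //= _ _.
have -> : (s.+1 * s.+3 * w.+2 = (s * (w.+2 * s.+1) + s.+2 + (w.+1 + w.+1) * s.+1).+1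
  + (w * s + w + 3 * s).+1)%N by ring.
lia.
Qed.

(** The left side bounds the degree of the final auxiliary polynomial; the right side is Q^2 / p + 3
    Q for Q = p r. *)
Lemma stepanov_degree (p r : nat) : (0 < r)%N -> (1 < p)%N ->
  (r.-1 + r.+1 * (p * r) + (p.-1 + p.-1) * r <= p * r * r + 3 * (p * r))%N.
Proof.
case: r p => [//|s] [|[|w]] //= _ _.
have -> : (w.+2 * s.+1 * s.+1 + 3 * (w.+2 * s.+1)
  = s + s.+2 * (w.+2 * s.+1) + (w.+1 + w.+1) * s.+1 + s.+2)%N by ring.
exact: leq_addr.
Qed.

(** * Stepanov's method over the field with Q^2 elements *)

Section Stepanov.
Variables (p : nat) (L : finFieldType) (pL : p \in [pchar L]).
Variables (k : nat) (c : L).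
Hypotheses (cardL : #|L| = (p ^ (k.+1 + k.+1))%N) (c_prime : c \in fixed pL 1).
Let p_gt1 : (1 < p)%N := prime_gt1 (pcharf_prime pL).
Let p_gt0 : (0 < p)%N := ltnW p_gt1.
Local Notation r := (p ^ k)%N.
Local Notation Q := (p ^ k.+1)%N.
Let r_gt0 : (0 < r)%N. Proof. by rewrite expn_gt0 p_gt0. Qed.
Local Notation h x := (trace pL k.+1 (x + c / x)).

(** The numerator of [h]: its deepest pole at 0 has order r = p^k, coming from i = k, and c is fixed
    by Frobenius. *)
Let H : {poly L} := \sum_(i < k.+1) ('X^(r + p ^ i) + c *: 'X^(r - p ^ i)).

Let hornerH x : x != 0 -> H.[x] = x ^+ r * h x.
Proof.
move=> x0; rewrite horner_sum /trace mulr_sumr; apply: eq_bigr => i _.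
have cF : frob pL i c = c by apply/fixedP/(fixed_trans (dvd1n i)).
rewrite rmorphD fmorph_div /= cF !hornerE mulrDr exprD; congr (_ + _).
have le_i : (p ^ i <= r)%N by rewrite leq_exp2l // -ltnS.
have <- : x ^+ (r - p ^ i) * x ^+ (p ^ i) = x ^+ r by rewrite -exprD subnK.
by rewrite /frob mulrACA mulfV ?expf_neq0 // mulr1 mulrC.
Qed.

Let sizeH : size H = (2 * r).+1.
Proof.
rewrite /H big_ord_recr /= subnn expr0 addnn -mul2n addrC.
have szX : size ('X^(2 * r) + c *: 1 : {poly L}) = (2 * r).+1.
  rewrite size_polyDl size_polyXn // (leq_ltn_trans (size_scale_leq _ _)) //.
  by rewrite size_poly1 ltnS muln_gt0.
rewrite size_polyDl szX // ltnS; apply: leq_trans (size_sum _ _ _) _.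
apply/bigmax_leqP => i _; apply: leq_trans (size_polyD _ _) _.
have lt_i : (p ^ i < r)%N by rewrite ltn_exp2l.
rewrite size_polyXn geq_max mul2n -addnn -addnS leq_add2l lt_i /=.
apply: leq_trans (size_scale_leq _ _) _; rewrite size_polyXn; lia.
Qed.

(* For j < p this is X^((p-1) r) (U / X^r)^j, free of denominators. *)
Let twist (U : {poly L}) j := U ^+ j * 'X^((p.-1 - j) * r).

Let size_twist (U : {poly L}) j : size U = (2 * r).+1 -> (j < p)%N ->
  size (twist U j) = ((p.-1 + j) * r).+1.
Proof.
move=> sU jp; have U0 : U != 0 by rewrite -size_poly_gt0 sU.
rewrite /twist size_mul ?expf_neq0 ?polyX_eq0 // size_polyXn.
have := size_exp U j; rewrite sU /= => sE.
have : (0 < size (U ^+ j)%R)%N by rewrite size_poly_gt0 expf_neq0.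
have -> : ((p.-1 + j) * r = (2 * r) * j + (p.-1 - j) * r)%N.
  by rewrite mulnAC -mulnDl; congr (_ * _)%N; lia.
rewrite -sE; move: (size _) (_ * r)%N => a b; lia.
Qed.

Let horner_twist (U : {poly L}) j x v : U.[x] = x ^+ r * v -> (j < p)%N ->
  (twist U j).[x] = x ^+ (p.-1 * r) * v ^+ j.
Proof.
move=> Ux jp; rewrite /twist !hornerE Ux exprMn mulrAC -exprM -exprD; congr (x ^+ _ * _).
by rewrite mulnC -mulnDl subnKC //; lia.
Qed.

(** The first term Q^2 / p is the average share of one trace value, the second is the error. *)
Lemma card_trace_kloosterman t : t \in fixed pL 1 ->
  (#|[set x : L | ((x != 0) && (trace pL (k.+1 + k.+1) (x + c / x) == t))%R]|
     <= p ^ (k.+1 + k) + 3 * p ^ k.+1)%N.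
Proof.
move=> t_prime; set Xt := finset _.
pose I := ('I_r * 'I_r.+2 * 'I_p)%type.
(* Up to the denominator-clearing factor, [G1] is x^(aQ+b) h^j and [G2] is its Q-th root x^(a+bQ)
   (t-h)^j at the points of [Xt]. A relation among the [G1] is transported to the [G2] by taking
   Q-th roots [D] of its coefficients. *)
pose G1 (i : I) := 'X^(i.1.1 * Q + i.1.2) * twist H i.2.
pose G2 (i : I) := 'X^(i.1.1 + i.1.2 * Q) * twist (t *: 'X^r - H) i.2.
have twist0 (U : {poly L}) (j : 'I_p) : size U = (2 * r).+1 -> twist U j != 0.
  by move=> sU; rewrite -size_poly_gt0 size_twist.
have sizeXn n (U : {poly L}) (j : 'I_p) : size U = (2 * r).+1 ->
    size ('X^n * twist U j) = (n + (p.-1 + j) * r).+1.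
  by move=> sU; rewrite size_monicM ?monicXn ?twist0 // size_polyXn size_twist // addnS.
have sizeH' : size (t *: 'X^r - H) = (2 * r).+1.
  rewrite addrC size_polyDl size_polyN sizeH //.
  rewrite (leq_ltn_trans (size_scale_leq _ _)) // size_polyXn; lia.
have QE : Q = (p * r)%N by rewrite expnS.
pose N := (r.-1 * Q + r.+1 + (p.-1 + p.-1) * r).+1.
have [||C [i0 Ci0] sumC] := @dependent_polys L I G1 N.
- move=> [[a b] j]; rewrite sizeXn //= ltnS !leq_add ?leq_mul //.
  + by rewrite -ltnS prednK.
  + by rewrite -ltnS.
  + by rewrite leq_add2l -ltnS prednK.
- by rewrite !card_prod !card_ord /N QE stepanov_count.
have [froot frootK rootK] := frob_bij pL k.+1.
pose D i := froot (C i); have DE i : frob pL k.+1 (D i) = C i by apply: rootK.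
pose Phi := \sum_i D i *: G2 i.
(* After removing (p-1) r, the degree of [G2] is (b p + j) r + a with a < r and j < p. These
   mixed-radix digits determine (a, b, j), so all degrees are distinct. *)
have Phi0 : Phi != 0.
  apply: contra Ci0 => /eqP/independent_polys D0.
  rewrite -DE D0 ?rmorph0 // => [i|[[a b] j] [[a' b'] j']].
    by rewrite mulf_neq0 ?twist0 // -size_poly_gt0 size_polyXn.
  have regroup (u v w s n : nat) :
      (u + v * (p * s) + (n + w) * s = n * s + ((v * p + w) * s + u))%N by ring.
  rewrite !sizeXn //= QE !regroup => -[/addnI].
  move=> /(congr1 (fun s => (s %/ r, s %% r)%N)).
  rewrite !divnMDl // !modnMDl !divn_small // !modn_small // !addn0 => -[eq_bj /val_inj->].
  move: eq_bj => /(congr1 (fun s => (s %/ p, s %% p)%N)).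
  rewrite !divnMDl // !modnMDl !divn_small // !modn_small // !addn0.
  by move=> -[/val_inj-> /val_inj->].
have sizePhi : (size Phi <= (r.-1 + r.+1 * Q + (p.-1 + p.-1) * r).+1)%N.
  apply: leq_trans (size_sum _ _ _) _; apply/bigmax_leqP => -[[a b] j] _.
  apply: leq_trans (size_scale_leq _ _) _; rewrite sizeXn //= ltnS !leq_add ?leq_mul //.
  + by rewrite -ltnS prednK.
  + by rewrite -ltnS.
  + by rewrite leq_add2l -ltnS prednK.
have rootPhi : all (root Phi) (enum Xt).
  apply/allP => x; rewrite mem_enum inE => /andP[x0 /eqP trx].
  (* The full trace is h + h^Q = t, so t - h = h^Q, and a second Q-th power returns h because
     x^(Q^2) = x on [L]. *)
  have tE : frob pL k.+1 (t - h x) = h x.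
    rewrite -trx trace_double -raddfB addrAC subrr add0r frob_trace -frob_add.
    by rewrite /frob -cardL expf_card.
  rewrite /root -(fmorph_eq0 (frob pL k.+1 : {rmorphism L -> L})) /= /Phi horner_sum rmorph_sum /=.
  pose w := x ^+ (p.-1 * r).
  have w0 : w != 0 by rewrite expf_neq0.
  (* The Q-th power of Phi(x) is the vanishing [G1] relation at x; w^Q / w adjusts for the factor
     x^((p-1) r) present in both twists. *)
  apply/eqP; transitivity (frob pL k.+1 w / w * (\sum_i C i *: G1 i).[x]); last first.
    by rewrite sumC horner0 mulr0.
  rewrite horner_sum mulr_sumr; apply: eq_bigr => -[[a b] j] _.
  rewrite !hornerZ rmorphM /= DE mulrCA; congr (_ * _).
  rewrite /G1 /G2 /= ![('X^_ * _).[x]]hornerM (horner_twist (hornerH x0)) //.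
  rewrite (@horner_twist _ _ _ (t - h x)) //; last first.
    by rewrite !hornerE hornerH // mulrBr mulrC.
  rewrite !hornerXn !rmorphM !rmorphXn /= tE.
  have -> : frob pL k.+1 x ^+ (a + b * Q) = x ^+ (a * Q + b).
    have fxx : frob pL k.+1 (frob pL k.+1 x) = x by rewrite -frob_add /frob -cardL expf_card.
    rewrite !exprD; congr (_ * _); first by rewrite /frob mulnC exprM.
    by rewrite mulnC exprM -/(frob pL k.+1 _) fxx.
  by rewrite -/w; field.
have := leq_trans (max_poly_roots Phi0 rootPhi (enum_uniq _)) sizePhi.
rewrite -cardE ltnS => /leq_trans; apply.
by rewrite expnD QE stepanov_degree.
Qed.
End Stepanov.

(** * From Stepanov's count to a bound on the sum *)

Section KloostermanBound.
Variables (p : nat) (L : finFieldType) (pL : p \in [pchar L]).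
Variables (C : numFieldType) (zeta : C).
Hypothesis zeta_prim : p.-primitive_root zeta.
Let p_gt0 : (0 < p)%N := prime_gt0 (pcharf_prime pL).

Lemma norm_psi (u : L) : `|psi p zeta u| = 1 :> C.
Proof.
rewrite /psi normrX; apply/eqP; rewrite (_ : `|zeta| = 1) ?expr1n //.
apply/eqP; rewrite -(pexpr_eq1 p_gt0) // -normrX.
by rewrite (prim_expr_order zeta_prim) normr1.
Qed.

(** Upper bounds on the counts suffice because their total is known. As the values of [psi] sum to
    0, the average M can be subtracted from each N t, and |N t - M| <= B + (M + B - N t). Summing
    over the p values of t gives 2 p B + 1 = 6 p Q + 1 with Q = p^(k+1). *)
Lemma norm_kloosterman_top (k : nat) (c : L) :
    #|L| = (p ^ (k.+1 + k.+1))%N -> c \in fixed pL 1 ->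
  `|kloosterman pL zeta c (k.+1 + k.+1)| <= (7 * p * p ^ k.+1)%:R.
Proof.
set m := (k.+1 + k.+1)%N => cardL c_prime.
have fixedT x : x \in fixed pL m by apply/fixedP; rewrite /frob -cardL expf_card.
pose N t := #|[set x : L | (x != 0) && (trace pL m (x + c / x) == t)]|.
have trF x : trace pL m x \in fixed pL 1 by apply: trace_prime_field.
have sumN : (\sum_(t in fixed pL 1) N t = (p ^ m).-1)%N.
  rewrite -cardL -(cardC1 (0 : L)) -sum1_card.
  rewrite [RHS](partition_big (fun x => trace pL m (x + c / x)) (mem (fixed pL 1))) //=.
  by apply: eq_bigr => t _; rewrite /N -sum1_card; apply: eq_bigl => x; rewrite !inE.
have sum_psi : \sum_(t in fixed pL 1) psi p zeta t = 0.
  have one_fixed : (1 : L) \in fixed pL 1 by apply/fixedP; rewrite rmorph1.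
  have := sum_psi_trace zeta_prim cardL (ltn0Sn 0) (dvd1n m) one_fixed.
  rewrite oner_eq0 => sum0; rewrite -[RHS]sum0.
  by apply: eq_bigr => t _; rewrite mulr1 /trace big_ord1 frob0.
pose M := (p ^ (k.+1 + k))%N; pose B := (3 * p ^ k.+1)%N.
have -> : kloosterman pL zeta c m = \sum_(t in fixed pL 1) ((N t)%:R - M%:R) * psi p zeta t.
  under [RHS]eq_bigr => t _ do rewrite mulrBl.
  rewrite sumrB -[X in _ - X]mulr_sumr sum_psi mulr0 subr0.
  rewrite /kloosterman (partition_big (fun x => trace pL m (x + c / x)) (mem (fixed pL 1))) //=.
  apply: eq_bigr => t _; rewrite mulr_natl -sumr_const.
  apply: eq_big => [x|x /andP[_ /eqP->] //].
  by rewrite inE fixedT.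
apply: le_trans (ler_norm_sum _ _ _) _.
have leN t : t \in fixed pL 1 -> (N t <= M + B)%N by apply: card_trace_kloosterman.
apply: (@le_trans _ _ (\sum_(t in fixed pL 1) ((M + B + B)%:R - (N t)%:R))).
  apply: ler_sum => t tF; rewrite normrM norm_psi mulr1.
  have -> : (N t)%:R - M%:R = B%:R - (M + B - N t)%:R :> C.
    by rewrite natrB ?leN // natrD; ring.
  apply: le_trans (ler_normB _ _) _; rewrite !normr_nat natrB ?leN //.
  by rewrite addrA -natrD [(B + _)%N]addnC.
rewrite sumrB sumr_const -natr_sum sumN (card_fixed pL _ (dvd1n m) cardL) // expn1.
have pM : (p * M = p ^ m)%N by rewrite -expnS /m addnS.
rewrite lerBlDr -mulrnA mulnC -natrD ler_nat 2!mulnDr pM /B mulnCA.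
have : (0 < p ^ m)%N by rewrite expn_gt0 p_gt0.
have : (0 < p * p ^ k.+1)%N by rewrite muln_gt0 expn_gt0 p_gt0.
rewrite -mulnA; move: (p * _)%N (p ^ m)%N => a b; lia.
Qed.

End KloostermanBound.

Lemma fixed_Fp (p : nat) (pF : p \in [pchar 'F_p]) a : a \in fixed pF 1.
Proof. by apply/fixedP; rewrite -[a]natr_Zp rmorph_nat. Qed.

(** * Embedding the prime field, and Weil's bound *)

Section PrimeFieldEmbedding.
Variables (p : nat) (L : finFieldType) (pL : p \in [pchar L]).
Let p_pr : prime p := pcharf_prime pL.

Definition of_Fp of p \in [pchar L] := fun a : 'F_p => (a : nat)%:R : L.

Lemma of_Fp_nat k : of_Fp pL k%:R = k%:R.
Proof. by rewrite /of_Fp val_Fp_nat // (GRing.natr_mod_pchar pL). Qed.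

Fact of_Fp_is_nmod_morphism : nmod_morphism (of_Fp pL).
Proof.
split=> [//|a b]; rewrite -[a]natr_Zp -[b]natr_Zp -natrD !of_Fp_nat.
by rewrite natrD.
Qed.

Fact of_Fp_is_monoid_morphism : monoid_morphism (of_Fp pL).
Proof.
split=> [|a b]; first exact: (of_Fp_nat 1).
by rewrite -[a]natr_Zp -[b]natr_Zp -natrM !of_Fp_nat natrM.
Qed.

HB.instance Definition _ :=
  GRing.isNmodMorphism.Build 'F_p L (of_Fp pL) of_Fp_is_nmod_morphism.
HB.instance Definition _ :=
  GRing.isMonoidMorphism.Build 'F_p L (of_Fp pL) of_Fp_is_monoid_morphism.

Variables (C : numFieldType) (zeta : C) (m : nat).
Hypotheses (zeta_prim : p.-primitive_root zeta) (cardL : #|L| = (p ^ m)%N).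
Variable pF : p \in [pchar 'F_p].

(** The level-one sum does not depend on the ambient field, so ever larger fields [L] constrain the
    same number. *)
Lemma kloosterman_prime_field c :
  kloosterman pL zeta (of_Fp pL c) 1 = kloosterman pF zeta c 1.
Proof.
have Fp_fixed a : of_Fp pL a \in fixed pL 1.
  by rewrite -[a]natr_Zp of_Fp_nat; apply/fixedP; rewrite rmorph_nat.
have psi_of_Fp a : psi p zeta (of_Fp pL a) = psi p zeta a.
  by rewrite -[a]natr_Zp of_Fp_nat (psi_nat pL) // (psi_nat pF).
rewrite /kloosterman; have -> : fixed pL 1 = of_Fp pL @: setT.
  apply/setP=> u; apply/idP/imsetP => [/(prime_fieldP _ cardL)[k _ ->]|[a _ ->//]].
  by exists k%:R; rewrite ?of_Fp_nat.
rewrite big_mkcondr big_imset /=; last by move=> a b _ _; apply: fmorph_inj.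
rewrite [RHS]big_mkcondr; apply: eq_big => [a|a _]; first by rewrite inE fixed_Fp.
by rewrite fmorph_eq0 /trace !big_ord1 !frob0 -psi_of_Fp rmorphD fmorph_div.
Qed.

End PrimeFieldEmbedding.

(** Repeated doubling yields |S_(2^(j+1))| >= (2 + 4^j e) p^(2^j), to be compared with Stepanov's
    bound at j = N; 4^N is then weakened to N. *)
Lemma kloosterman_growth (p : nat) (p_pr : prime p) (C : numFieldType) (zeta : C) (c : 'F_p)
    (e : C) (N : nat) :
    p.-primitive_root zeta -> c != 0 -> 0 <= e ->
    (4 + e) * p%:R <= `|kloosterman (pchar_Fp p_pr) zeta c 1| ^+ 2 ->
  2 + N%:R * e <= (7 * p)%:R.
Proof.
move=> zeta_prim c0 e0 big_e.
(* Degree 2^(N+1) contains every level 2^j with j <= N + 1 as a subfield. *)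
have [L pL cardL] := pPrimePowerField p_pr (expn_gt0 2 N.+1 : (0 < 2 ^ N.+1)%N).
pose K j := `|kloosterman pL zeta (of_Fp pL c) (2 ^ j)|.
have c_fixed : of_Fp pL c \in fixed pL 1.
  by rewrite -[c]natr_Zp of_Fp_nat; apply/fixedP; rewrite rmorph_nat.
have c0' : of_Fp pL c != 0 by rewrite fmorph_eq0.
pose q j : C := (p ^ (2 ^ j))%:R.
have qS j : q j.+1 = q j ^+ 2 by rewrite /q expnSr expnM natrX.
have q_gt0 j : 0 < q j by rewrite ltr0n expn_gt0 prime_gt0.
have step j : (j <= N)%N -> K j ^+ 2 - 2 * q j <= K j.+1.
  move=> jN; rewrite /K (_ : 2 ^ j.+1 = 2 ^ j + 2 ^ j)%N; last by rewrite expnS mul2n addnn.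
  rewrite (kloosterman_double zeta_prim cardL) ?expn_gt0 //; last first.
    by rewrite addnn -mul2n -expnS dvdn_exp2l.
  rewrite distrC -normrX lerBlDr.
  rewrite -[X in _ <= _ + X](ger0_norm (mulr_ge0 _ (ltW (q_gt0 j)))) //.
  by apply: le_trans (ler_normD _ _); rewrite subrK.
have grow j : (j <= N)%N -> (2 + 4 ^+ j * e) * q j <= K j.+1.
  elim: j => [_|j IH jN].
    apply: le_trans (step 0%N isT); rewrite lerBrDr expr0 mul1r -mulrDl.
    by rewrite /K expn0 (kloosterman_prime_field pL zeta_prim cardL (pchar_Fp p_pr)) addrAC -natrD.
  have x0 : 0 <= 4 ^+ j * e by rewrite mulr_ge0 ?exprn_ge0.
  apply: le_trans (step j.+1 jN); rewrite lerBrDr.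
  apply: (@le_trans _ _ (((2 + 4 ^+ j * e) * q j) ^+ 2)).
    rewrite exprMn -qS -mulrDl ler_pM2r // -subr_ge0.
    (* Squaring and subtracting 2 sends 2 + y to 2 + 4 y + y^2, so the excess over 2 at least
       quadruples. *)
    have -> : (2 + 4 ^+ j * e) ^+ 2 - (2 + 4 ^+ j.+1 * e + 2) = (4 ^+ j * e) ^+ 2.
      by rewrite [4 ^+ j.+1]exprS -mulrA; move: (4 ^+ j * e) => y; ring.
    exact: exprn_ge0.
  by rewrite ler_pXn2r ?nnegrE ?IH ?normr_ge0 ?(ltnW jN) // mulr_ge0 ?addr_ge0 ?(ltW (q_gt0 j)).
have := grow N (leqnn N).
have /prednK nE : (0 < 2 ^ N)%N by rewrite expn_gt0.
have top : K N.+1 <= (7 * p)%:R * q N.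
  rewrite /K /q -natrM expnS mul2n -addnn -nE.
  by apply: norm_kloosterman_top => //; rewrite nE addnn -mul2n -expnS.
move=> /le_trans/(_ top); rewrite ler_pM2r //; apply: le_trans.
rewrite lerD2l ler_wpM2r // -natrX ler_nat.
exact/ltnW/(leq_trans (ltn_expl N (isT : 1 < 4)%N)).
Qed.

(** Otherwise the excess e = |K|^2 / p - 4 is a positive real with 2 + n e <= 7 p for every n,
    against the archimedean property. *)
Lemma kloosterman_weil (p : nat) (p_pr : prime p) (R : archiRcfType) (zeta : R[i]) (c : 'F_p) :
    p.-primitive_root zeta -> c != 0 ->
  `|kloosterman (pchar_Fp p_pr) zeta c 1| ^+ 2 <= (4 * p)%:R.
Proof.
move=> zeta_prim c0; set K := kloosterman _ _ _ _.
have p0 : 0 < p%:R :> R by rewrite ltr0n prime_gt0.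
have [s KE] : exists s : R, `|K| ^+ 2 = s%:C%C.
  by exists (complex.Re K ^+ 2 + complex.Im K ^+ 2); rewrite add_Re2_Im2.
rewrite KE -(rmorph_nat (real_complex R)) lecR leNgt; apply/negP => lt_s.
pose e := s / p%:R - 4.
have e0 : 0 < e by rewrite subr_gt0 ltr_pdivlMr // -natrM.
have bound n : 2 + n%:R * e <= (7 * p)%:R.
  rewrite -lecR rmorphD rmorphM !rmorph_nat.
  apply: (kloosterman_growth n zeta_prim c0); first by rewrite ler0c ltW.
  rewrite -/K KE -!(rmorph_nat (real_complex R)) -rmorphD -rmorphM lecR.
  by rewrite /e addrC subrK divfK // gt_eqF.
have := Num.Theory.archi_boundP (ltW (divr_gt0 (ltr0Sn R (7 * p)) e0)).
rewrite ltr_pdivrMr // => lt_n; have := bound (Num.bound ((7 * p).+1%:R / e)).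
apply/negP; rewrite -ltNge; move: lt_n; rewrite -natr1; lra.
Qed.

(** * Sums over the prime field *)

Section LegendreSymbol.
Variables (p : nat) (p_pr : prime p) (p_odd : p != 2%N).

Definition nsqrt (u : 'F_p) := #|[set y | y ^+ 2 == u]|.
Local Arguments nsqrt u%_R.

(** With this form, a sum weighted by 1 + chi becomes a sum over square roots by [sum_nsqrt]. *)
Definition quad_char (u : 'F_p) : int := (nsqrt u)%:Z - 1.

Let two_neq0 : 2%:R != 0 :> 'F_p.
Proof.
rewrite -(dvdn_pcharf (pchar_Fp p_pr)); apply: contra p_odd.
by rewrite dvdn_prime2.
Qed.

Lemma nsqrt0 : nsqrt 0 = 1%N.
Proof.
rewrite /nsqrt -(cards1 (0 : 'F_p)); congr #|pred_of_set _|.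
by apply/setP=> y; rewrite !inE expf_eq0.
Qed.

Lemma nsqrt_sqr (y : 'F_p) : y != 0 -> nsqrt (y ^+ 2) = 2%N.
Proof.
move=> y0; have -> : nsqrt (y ^+ 2) = #|[set y; - y]|.
  by congr #|pred_of_set _|; apply/setP=> x; rewrite !inE eqf_sqr.
by rewrite cards2 -addr_eq0 -mulr2n -mulr_natl mulf_neq0.
Qed.

Lemma nsqrt_eq0 u : (nsqrt u == 0%N) = ~~ [exists y, y ^+ 2 == u].
Proof.
rewrite cards_eq0; apply/idP/idP => [/eqP e0|].
  by apply/existsPn => y; have := in_set0 y; rewrite -e0 inE => ->.
by move/existsPn=> nu; apply/eqP/setP => y; rewrite !inE; apply/negbTE.
Qed.

Variant nsqrt_spec (u : 'F_p) : nat -> Prop :=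
| NsqrtZero of u = 0 : nsqrt_spec u 1
| NsqrtSquare y of y != 0 & u = y ^+ 2 : nsqrt_spec u 2
| NsqrtNonsquare of (forall y, y ^+ 2 != u) : nsqrt_spec u 0.

Lemma nsqrtP u : nsqrt_spec u (nsqrt u).
Proof.
have [->|u0] := eqVneq u 0; first by rewrite nsqrt0; apply: NsqrtZero.
have [/existsP[y /eqP yu]|nu] := boolP [exists y, y ^+ 2 == u]; last first.
  have := nu; rewrite -nsqrt_eq0 => /eqP->; apply: NsqrtNonsquare => y.
  by have /existsPn := nu.
have y0 : y != 0 by apply: contra u0; rewrite -yu => /eqP->; rewrite expr0n.
by rewrite -yu nsqrt_sqr //; apply: NsqrtSquare y0 _.
Qed.

Lemma sum_nsqrt (V : nmodType) (F : 'F_p -> V) : \sum_u F u *+ nsqrt u = \sum_y F (y ^+ 2).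
Proof.
rewrite [RHS](partition_big (fun y => y ^+ 2) predT) //=; apply: eq_bigr => u _.
rewrite -sumr_const; apply: eq_big => [y|y]; first by rewrite inE.
by rewrite inE => /eqP->.
Qed.

(* If [u] is a nonsquare, [v] and [u v] have at most two square roots in total; summed over
   all [v] this bound is attained. *)
Lemma quad_charM : {morph quad_char : u v / u * v}.
Proof.
move=> u v; rewrite /quad_char; case: (nsqrtP u) => [->|y y0 ->|nu].
- by rewrite mul0r nsqrt0 mul0r.
- rewrite mul1r; congr (_%:Z - 1); rewrite /nsqrt.
  rewrite -(card_imset [set x | x ^+ 2 == v] (mulfI y0)); congr #|pred_of_set _|.
  apply/setP=> x; rewrite inE; apply/eqP/imsetP => [xyv|[w]].
    exists (x / y); last by rewrite mulrC divfK.
    by rewrite inE expr_div_n xyv mulrC mulKf // expf_neq0.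
  by rewrite inE => /eqP<- ->; rewrite exprMn.
pose D w := (2 - (nsqrt w + nsqrt (u * w)))%N.
have u0 : u != 0 by have := nu 0; rewrite expr0n eq_sym.
have le2 w : (nsqrt w + nsqrt (u * w) <= 2)%N.
  case: (nsqrtP w) => [->|y y0 ->|nw]; first by rewrite mulr0 nsqrt0.
    case: nsqrtP => [/eqP|z _ zE|//].
      by rewrite mulf_eq0 (negPf u0) expf_eq0 (negPf y0).
    by have := nu (z / y); rewrite expr_div_n -zE mulfK ?expf_neq0 // eqxx.
  by case: nsqrtP.
have sum1 : (\sum_w nsqrt w = p)%N.
  have := sum_nsqrt (fun _ => 1%N); rewrite sum1_card card_Fp // => sum1.
  by rewrite -[RHS]sum1; apply: eq_bigr => w _; rewrite natn.
have sumu : (\sum_w nsqrt (u * w) = p)%N by rewrite -[RHS]sum1 [RHS](reindex_inj (mulfI u0)).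
have : (\sum_w D w + (\sum_w nsqrt w + \sum_w nsqrt (u * w)) = p * 2)%N.
  rewrite -!big_split /=; under eq_bigr => w _ do rewrite subnK ?le2 //.
  by rewrite sum_nat_const card_Fp.
rewrite sum1 sumu muln2 -addnn -[RHS]add0n => /addIn/eqP.
rewrite sum_nat_eq0 => /forallP/(_ v); rewrite /D subn_eq0 => ge2.
have : (nsqrt v + nsqrt (u * v) == 2)%N by rewrite eqn_leq le2.
by move=> /eqP; lia.
Qed.

(** * Gauss sums, the Kloosterman sum and the four classes *)

Section CharacterSums.
Variables (R : archiRcfType) (zeta : R[i]).
Hypothesis zeta_prim : p.-primitive_root zeta.
Local Notation C := R[i].
Local Notation psi := (psi p zeta : 'F_p -> C).
Local Notation chi u := ((quad_char u)%:~R : C).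
Let pF := pchar_Fp p_pr.
Let cardF : #|'F_p| = (p ^ 1)%N. Proof. by rewrite card_Fp. Qed.
Let psi_add a b : psi (a + b) = psi a * psi b.
Proof. by rewrite (psiD zeta_prim cardF) ?fixed_Fp. Qed.

Lemma sum_psi (u : 'F_p) : \sum_a psi (a * u) = if u == 0 then p%:R else 0.
Proof.
have := sum_psi_trace zeta_prim cardF (ltn0Sn 0) (dvd1n 1) (fixed_Fp pF u).
rewrite expn1 => <-; apply: eq_big => [a|a _]; first by rewrite fixed_Fp.
by rewrite /trace big_ord1 frob0.
Qed.

Lemma sum_psi1 : \sum_a psi a = 0.
Proof.
have := sum_psi 1; rewrite oner_eq0 => sum0; rewrite -[RHS]sum0.
by apply: eq_bigr => a _; rewrite mulr1.
Qed.

Lemma chiE u : chi u = (nsqrt u)%:R - 1.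
Proof. by rewrite /quad_char rmorphB rmorph1. Qed.

Lemma norm_psi_Fp a : `|psi a| = 1. Proof. exact: (norm_psi pF zeta_prim). Qed.

Lemma conj_psi a : (psi a)^* = psi (- a).
Proof.
have psi_neq0 : psi a != 0 by rewrite -normr_eq0 norm_psi_Fp oner_eq0.
apply: (mulfI psi_neq0); rewrite -normCK norm_psi_Fp expr1n -psi_add subrr.
by rewrite (psi0 pF zeta_prim).
Qed.

(** Setting y^2 = 2(a + e) turns this into a quadratic exponential sum. In its squared modulus put y
    = w + z: the exponent is w^2 / 2 + z w, and the sum over z kills every w except 0. *)
Lemma norm_gauss_sum e : `|\sum_a chi (2 * (a + e)) * psi a| ^+ 2 = p%:R.
Proof.
have -> : \sum_a chi (2 * (a + e)) * psi a = \sum_y psi (y ^+ 2 / 2 - e).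
  rewrite -(sum_nsqrt (fun u => psi (u / 2 - e))).
  under eq_bigr => a _ do rewrite chiE mulrBl mul1r.
  rewrite sumrB sum_psi1 subr0 [RHS](reindex_inj (mulfI two_neq0)).
  rewrite [RHS](reindex_inj (addIr e)); apply: eq_bigr => a _ /=.
  by rewrite [2 * _]mulrC mulfK // addrK mulr_natl.
rewrite normCK rmorph_sum mulr_sumr /=.
transitivity (\sum_z \sum_w psi (w ^+ 2 / 2) * psi (z * w)).
  apply: eq_bigr => z _; rewrite mulr_suml (reindex_inj (addIr z)).
  apply: eq_bigr => w _; rewrite conj_psi -!psi_add; congr (psi _).
  by field.
rewrite exchange_big (bigD1 0) //= [X in _ + X]big1 => [|w w0]; last first.
  by rewrite -mulr_sumr sum_psi (negPf w0) mulr0.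
by rewrite addr0 -mulr_sumr sum_psi eqxx expr0n mul0r (psi0 pF zeta_prim) mul1r.
Qed.

Lemma sum_chi_kloosterman :
  \sum_a chi (a ^+ 2 - 1) * psi a = kloosterman pF zeta 4^-1 1.
Proof.
under eq_bigr => a _ do rewrite chiE mulrBl mul1r.
rewrite sumrB sum_psi1 subr0 /kloosterman.
rewrite [RHS](partition_big (fun x => x + 4^-1 / x) predT) //=; apply: eq_bigr => a _.
transitivity (\sum_(x in fixed pF 1 | (x != 0) && (x + 4^-1 / x == a)) psi a); last first.
  apply: eq_big => [x|x /andP[_ /andP[_ /eqP<-]]]; first by rewrite andbA.
  by rewrite /trace big_ord1 frob0.
(* The two reindexings set y = 2x - a, and then y^2 - (a^2 - 1) = 4x (x + 1/(4x) - a). The value x =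
   0 gives no square root, as a^2 differs from a^2 - 1. *)
rewrite mulr_natl -sumr_const; rewrite (reindex_inj (addIr (- a))) (reindex_inj (mulfI two_neq0)).
apply: eq_bigl => x; rewrite inE fixed_Fp /=.
have four0 : 4 != 0 :> 'F_p by rewrite (_ : 4 = 2 * 2) ?mulf_neq0 // -natrM.
have [->|x0] /= := eqVneq x 0.
  by rewrite mulr0 sub0r sqrrN -subr_eq0 opprB addrC subrK oner_eq0.
rewrite -subr_eq0 -[RHS]subr_eq0.
have -> : (2 * x - a) ^+ 2 - (a ^+ 2 - 1) = 4 * x * (x + 4^-1 / x - a).
  by field; rewrite four0 x0.
by rewrite !mulf_eq0 (negPf four0) (negPf x0).
Qed.

Lemma quad_char_sign u : u != 0 -> quad_char u = 1 \/ quad_char u = - 1.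
Proof.
by rewrite /quad_char; case: nsqrtP => [->|y _ _ _|_ _]; [rewrite eqxx | left | right].
Qed.

Lemma quad_char0 : quad_char 0 = 0. Proof. by rewrite /quad_char nsqrt0. Qed.

Lemma norm_chi_le1 u : `|chi u| <= 1.
Proof.
have [->|/quad_char_sign[]->] := eqVneq u 0; first by rewrite quad_char0 normr0 ler01.
  by rewrite rmorph1 normr1.
by rewrite rmorphN1 normrN1.
Qed.

(** Four times the class sum is bounded by 2s for the Kloosterman sum, s for each Gauss sum and 2
    for each of the exceptional points 1 and -1. *)
Lemma norm_class_sum (s : C) (eps delta : int) :
    0 <= s -> s ^+ 2 = p%:R -> (eps = 1 \/ eps = - 1) -> (delta = 1 \/ delta = - 1) ->
  `|\sum_(a | (quad_char (a ^+ 2 - 1) == eps) && (quad_char (2 * (a + 1)) == delta)) psi a|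
    <= s + 1.
Proof.
move=> s0 s2 eps1 delta1; set S := \sum_(a | _) _.
pose e : C := eps%:~R; pose d : C := delta%:~R.
have ne : `|e| = 1 by rewrite /e; case: eps1 => ->; rewrite ?rmorphN1 ?rmorph1 ?normrN1 ?normr1.
have nd : `|d| = 1 by rewrite /d; case: delta1 => ->; rewrite ?rmorphN1 ?rmorph1 ?normrN1 ?normr1.
(* The expanded product (1 + eps chi(a^2-1)) (1 + delta chi(2(a+1))) times psi(a), with chi(2(a-1))
   replacing the product of the two characters. They agree when a + 1 is nonzero, since chi(a+1)^2 =
   1. *)
pose X a := psi a + e * (chi (a ^+ 2 - 1) * psi a) + d * (chi (2 * (a + 1)) * psi a)
  + e * d * (chi (2 * (a + (- 1))) * psi a).
have sqr_sub1 a : a ^+ 2 - 1 = (a - 1) * (a + 1) :> 'F_p by ring.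
have N11 : -1 != 1 :> 'F_p.
  by rewrite -subr_eq0 -opprD oppr_eq0 -[1 + 1](natrD _ 1 1).
have sumX : \sum_a X a = 4 * S + (X 1 + X (-1)).
  rewrite (bigD1 1) //= (bigD1 (-1)) //= addrA [RHS]addrC; congr (_ + _).
  rewrite /S mulr_sumr big_mkcond [RHS]big_mkcond; apply: eq_bigr => a _.
  have [->|a1] /= := eqVneq a 1.
    by rewrite expr1n subrr quad_char0; case: eps1 => ->.
  have [->|aN1] /= := eqVneq a (-1).
    by rewrite sqrrN expr1n subrr quad_char0; case: eps1 => ->.
  have ap0 : a + 1 != 0 by rewrite -[1]opprK subr_eq0.
  have am0 : a - 1 != 0 by rewrite subr_eq0.
  have sign_ap : quad_char (a + 1) ^+ 2 = 1.
    by case: (quad_char_sign ap0) => ->; rewrite ?sqrrN expr1n.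
  have e3 : quad_char (2 * (a - 1)) = quad_char (a ^+ 2 - 1) * quad_char (2 * (a + 1)).
    rewrite -quad_charM sqr_sub1 -[LHS]mulr1 -sign_ap expr2 -!quad_charM; congr quad_char.
    ring.
  rewrite /X e3 rmorphM /e /d.
  have sgn1 : quad_char (a ^+ 2 - 1) = 1 \/ quad_char (a ^+ 2 - 1) = - 1.
    by apply: quad_char_sign; rewrite sqr_sub1 mulf_neq0.
  have sgn2 := quad_char_sign (mulf_neq0 two_neq0 ap0).
  by case: eps1 => ->; case: delta1 => ->; case: sgn1 => ->; case: sgn2 => -> /=;
    rewrite ?rmorphN1 ?rmorph1 /=; ring.
(* Here chi(a^2-1) and one of chi(2(a+1)), chi(2(a-1)) vanish, which leaves two terms of modulus at
   most 1. *)
have leX a : a ^+ 2 = 1 -> `|X a| <= 2.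
  move=> a2; rewrite /X a2 subrr quad_char0 mul0r mulr0 addr0.
  have /eqP : (a - 1) * (a + 1) = 0 by rewrite -sqr_sub1 a2 subrr.
  rewrite mulf_eq0 => /orP[] /eqP ->; rewrite mulr0 quad_char0 mul0r mulr0 ?addr0;
  apply: le_trans (ler_normD _ _) _; rewrite ?addr0 !normrM ?ne ?nd ?norm_psi_Fp ?mul1r ?mulr1;
  by rewrite (_ : 2 = 1 + 1) ?lerD ?norm_chi_le1 // -natrD.
have leG b : `|\sum_a chi (2 * (a + b)) * psi a| <= s.
  by rewrite -ler_sqr ?nnegrE // norm_gauss_sum s2.
have leK : `|\sum_a chi (a ^+ 2 - 1) * psi a| <= 2 * s.
  rewrite -ler_sqr ?nnegrE ?mulr_ge0 // sum_chi_kloosterman exprMn s2 -natrX -natrM.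
  by apply: kloosterman_weil => //; rewrite invr_eq0 (_ : 4 = 2 * 2) ?mulf_neq0 // -natrM.
have {}sumX : 4 * S = e * (\sum_a chi (a ^+ 2 - 1) * psi a)
    + d * (\sum_a chi (2 * (a + 1)) * psi a)
    + e * d * (\sum_a chi (2 * (a + (- 1))) * psi a) - X 1 - X (-1).
  apply: (addIr (X 1 + X (-1))); rewrite -sumX /X !big_split /= sum_psi1 -!mulr_sumr.
  by ring.
rewrite -(ler_pM2l (_ : 0 < 4)) //.
rewrite -[4 in X in X <= _]ger0_norm // -normrM sumX.
have -> : 4 * (s + 1) = 2 * s + s + s + 2 + 2 by ring.
do 2![apply: le_trans (ler_normB _ _) _; apply: lerD; last by apply: leX; rewrite ?sqrrN expr1n].
do 2![apply: le_trans (ler_normD _ _) _; apply: lerD; rewrite ?normrM ?ne ?nd ?mul1r //].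
Qed.



End CharacterSums.
End LegendreSymbol.

(** * The sums of the theorem *)

(* Imported only here because these libraries rebind the scope keys %N, %R, %Z and %C. *)
Require Import Defs.
From Stdlib Require Import Reals ZArith List Znumtheory.
From Coquelicot Require Import Coquelicot.
Local Open Scope ring_scope.

(** * Complex numbers as pairs of reals, and the root of unity *)

Definition to_complex (z : C) : R[i] := Complex (fst z) (snd z).

Lemma to_complexM z w : to_complex (Cmult z w) = to_complex z * to_complex w.
Proof. by []. Qed.

Lemma to_complexX z n : to_complex (Cpow z n) = to_complex z ^+ n.
Proof. by elim: n => [//|n IH]; rewrite exprS -IH -to_complexM. Qed.

Lemma norm_to_complex z : `|to_complex z| = real_complex R (Cmod z).
Proof. by rewrite normc_def /Cmod RsqrtE !RpowE. Qed.

Lemma Cpow_polar (t : R) n :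
  Cpow (cos t, sin t) n = (cos (INR n * t), sin (INR n * t)).
Proof.
elim: n => [|n IH]; first by rewrite /= Rmult_0_l cos_0 sin_0.
rewrite S_INR Rmult_plus_distr_r Rmult_1_l Rplus_comm cos_plus sin_plus.
rewrite [LHS]/= IH /Cmult /=; congr pair.
exact: Rplus_comm.
Qed.

(** The order divides the prime p, so it is 1 or p; it is not 1 because 0 < 2 pi / p < pi makes the
    sine positive. *)
Lemma zeta_primitive (p : nat) : prime.prime p -> p != 2%nat ->
  p.-primitive_root (to_complex (zeta p)).
Proof.
move=> p_pr p_odd.
have p_ge3 : (2 < p)%nat by rewrite ltn_neqAle eq_sym p_odd prime_gt1.
have INRp : (3 <= INR p)%R.
  apply: (Rle_trans _ (INR 3%nat)); first by simpl; Lra.lra.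
  exact/le_INR/ssrnat.leP.
have zp : to_complex (zeta p) ^+ p = 1.
  rewrite -to_complexX Cpow_polar.
  have -> : (INR p * (2 * PI / INR p) = 2 * PI)%R by field; Lra.lra.
  by rewrite cos_2PI sin_2PI.
have [m mprim dvd_m] := prim_order_exists (prime_gt0 p_pr) zp.
have [/eqP m1|/eqP mp] : (m == 1%nat) \/ (m == p); last by rewrite mp in mprim.

  by case/primeP: p_pr => _ /(_ m dvd_m) /orP.
suff : to_complex (zeta p) != 1 by rewrite -(prim_expr_order mprim) m1 expr1 eqxx.
have sin_pos : (0 < sin (2 * PI / INR p))%R.
  have PI_pos := PI_RGT_0.
  apply: sin_gt_0; first by apply: Rdiv_lt_0_compat; Lra.lra.
  by apply/Rlt_div_l; Lra.nra.
by apply/eqP => -[_ /= sin0]; move: sin_pos; rewrite sin0 => /Rlt_irrefl.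
Qed.

(** * Integers modulo p and the Legendre symbol *)

Section Residues.
Variables (p : nat) (p_prime : prime.prime p) (p_odd : p != 2%nat).

Definition residue (z : Z) : 'F_p := (int_of_Z z)%:~R.

Lemma residueD z w : residue (z + w) = residue z + residue w.
Proof. by rewrite /residue -[(z + w)%Z]/(z + w) !rmorphD. Qed.
Lemma residueB z w : residue (z - w) = residue z - residue w.
Proof. by rewrite /residue -[(z - w)%Z]/(z - w) !rmorphB. Qed.
Lemma residueM z w : residue (z * w) = residue z * residue w.
Proof. by rewrite /residue -[(z * w)%Z]/(z * w) !rmorphM. Qed.
Lemma residue_nat n : residue (Z.of_nat n) = n%:R.
Proof. by rewrite /residue -[n in LHS]natn rmorph_nat !rmorph_nat. Qed.
Lemma residue_eq0 z : (residue z == 0) = Z.eqb (z mod Z.of_nat p) 0.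
Proof.
have p0 : Z.of_nat p <> 0%Z by have := prime_gt0 p_prime; lia.
have residue_p : residue (Z.of_nat p) = 0.
  by rewrite residue_nat (pcharf0 (pchar_Fp p_prime)).
have {1}-> := Z.div_mod z _ p0.
have /Z2Nat.id := proj1 (Z.mod_pos_bound z (Z.of_nat p) ltac:(lia)).
move: (z mod _)%Z (Z.mod_pos_bound z (Z.of_nat p) ltac:(lia)) => r r_bound rE.
rewrite residueD residueM residue_p mul0r add0r -rE residue_nat -(dvdn_pcharf (pchar_Fp p_prime)).
apply/idP/idP => [/dvdn_leq|/Z.eqb_eq]; last by rewrite rE => ->.
by move=> le_p; apply/Z.eqb_eq; lia.
Qed.

Lemma legendre_quad_char z : legendre z (Z.of_nat p) = Z_of_int (quad_char (residue z)).
Proof.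
rewrite /legendre -residue_eq0; have [->|z0] := eqVneq (residue z) 0.
  by rewrite quad_char0.
rewrite /quad_char; case: (nsqrtP p_prime p_odd) => [z1|y _ yz|nz]; first by rewrite z1 eqxx in z0.
  rewrite (_ : existsb _ _ = true) //; apply/existsb_exists.
  exists (Z.of_nat y); split.
    apply/in_map/in_seq; rewrite Nat2Z.id; split; first exact: Nat.le_0_l.
    by apply/ssrnat.ltP; have := ltn_ord y; rewrite {2}Fp_cast.
  by rewrite -residue_eq0 residueB residueM residue_nat natr_Zp yz subrr.
rewrite (_ : existsb _ _ = false) //; apply/negbTE/negP => /existsb_exists[x [_]].
rewrite -residue_eq0 residueB residueM subr_eq0 => xz.
by have := nz (residue x); rewrite expr2 xz.
Qed.

End Residues.

Lemma to_complex_sum (f : nat -> C) (P : pred nat) (s : list nat) :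
  to_complex (fold_right Cplus (RtoC 0) (List.map f (List.filter P s)))
    = \sum_(a <- s | P a) to_complex (f a).
Proof.
elim: s => [|a s IH]; first by rewrite big_nil.
by rewrite big_cons /=; case: (P a); rewrite -IH.
Qed.

Lemma list_seqE m n : List.seq m n = seq.iota m n.
Proof. by elim: n m => //= n IH m; rewrite IH. Qed.

(** [Rp] omits exactly the residues 1 and p - 1, the two square roots of 1, where no class condition
    can hold. *)
Lemma sum_Rp (V : nmodType) (p : nat) (P : pred nat) (F : nat -> V) :
    (2 < p)%nat -> ~~ P 1%nat -> ~~ P p.-1 ->
  \sum_(a <- Rp p | P a) F a = \sum_(0 <= a < p | P a) F a.
Proof.
case: p => [|[|[|p]]] // _ P1 Pp.
have -> : index_iota 0 p.+3 = [:: 0%nat, 1%nat & seq.iota 2 p ++ [:: p.+2]].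
  by rewrite /index_iota subn0 /= -(seq.iotaD 2 p 1) addn1.
have -> : Rp p.+3 = 0%nat :: seq.iota 2 p by rewrite /Rp list_seqE; congr (_ :: seq.iota _ _); lia.
by rewrite !big_cons big_cat big_cons big_nil (negPf P1) (negPf Pp) /= addr0.
Qed.

Lemma sum_Fp (p : nat) (V : nmodType) (P : pred nat) (F : nat -> V) :
  prime.prime p -> \sum_(a : 'F_p | P a) F a = \sum_(0 <= a < p | P a) F a.
Proof. by move=> p_pr; rewrite -[in RHS](Fp_cast p_pr) big_mkord. Qed.

Lemma prime_of_Z (p : nat) : prime (Z.of_nat p) -> prime.prime p.
Proof.
move=> p_prime; have p_gt1 := prime_ge_2 _ p_prime.
apply/primeP; split=> [|d /dvdnP[k pE]]; first by lia.
have /(prime_divisors _ p_prime) : (Z.of_nat d | Z.of_nat p)%Z.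
  by exists (Z.of_nat k); rewrite pE; lia.
by case=> [|[|[|]]] dE; apply/orP; [lia | left; lia | right; lia | lia].
Qed.

Lemma ged_quad_char (p : nat) (eps delta : Z) (p_pr : prime.prime p) (p_odd : p != 2%nat) :
    (eps = 1%Z \/ eps = (-1)%Z) ->
  to_complex (ged p eps delta)
    = \sum_(a : 'F_p | (quad_char (a ^+ 2 - 1) == int_of_Z eps)
                       && (quad_char (2 * (a + 1)) == int_of_Z delta))
        psi p (to_complex (zeta p)) a.
Proof.
move=> eps1; have p_gt2 : (2 < p)%nat by rewrite ltn_neqAle eq_sym p_odd prime_gt1.
pose P (a : nat) := (quad_char ((a%:R : 'F_p) ^+ 2 - 1) == int_of_Z eps)
  && (quad_char (2 * ((a%:R : 'F_p) + 1)) == int_of_Z delta).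
(* If a^2 = 1 the first symbol is 0, which is neither value of [eps]. *)
have NP a : (a%:R : 'F_p) ^+ 2 = 1 -> ~~ P a.
  by rewrite /P => ->; rewrite subrr quad_char0 //; case: eps1 => ->.
have Zeqb u z : Z.eqb (Z_of_int u) z = (u == int_of_Z z).
  rewrite -(eqtype.inj_eq (can_inj Z_of_intK)) int_of_ZK.
  by apply/idP/eqP => [/Z.eqb_eq|->] //; apply: Z.eqb_refl.
rewrite to_complex_sum (eq_bigl P) => [|a]; last first.
  cbv zeta; rewrite !legendre_quad_char // !Zeqb residueB !residueM residueD.
  by rewrite -[1%Z]/(Z.of_nat 1) -[2%Z]/(Z.of_nat 2) !residue_nat.
rewrite sum_Rp // ?NP ?expr1n //; last first.
  by rewrite -subn1 natrB ?prime_gt0 // (pcharf0 (pchar_Fp p_pr)) sub0r sqrrN expr1n.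
rewrite -sum_Fp //; apply: eq_big => [a|a _]; first by rewrite /P natr_Zp.
by rewrite -[in RHS](natr_Zp a) (psi_nat (pchar_Fp p_pr) (zeta_primitive p_pr p_odd)) to_complexX.
Qed.

Lemma norm_ged (p : nat) (eps delta : Z) : prime.prime p -> p != 2%nat ->
    (eps = 1%Z \/ eps = (-1)%Z) -> (delta = 1%Z \/ delta = (-1)%Z) ->
  Cmod (ged p eps delta) <= sqrt (INR p) + 1.
Proof.
move=> p_pr p_odd eps1 delta1.
have sign z : z = 1%Z \/ z = (-1)%Z -> int_of_Z z = 1 \/ int_of_Z z = - 1.
  by case=> ->; [left | right].
pose s := real_complex R (sqrt (INR p)).
have s0 : 0 <= s by rewrite ler0c RsqrtE sqrtr_ge0.
have s2 : s ^+ 2 = p%:R.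
  by rewrite -rmorphXn /= RsqrtE sqr_sqrtr INRE ?ler0n // rmorph_nat.
have := norm_class_sum p_pr p_odd (zeta_primitive p_pr p_odd) s0 s2 (sign _ eps1) (sign _ delta1).
by rewrite -ged_quad_char // norm_to_complex -(rmorph1 (real_complex R)) -rmorphD lecR.
Qed.

Open Scope R_scope.

Theorem theorem3p6 :
  forall (p : nat), prime (Z.of_nat p) -> p <> 2%nat ->
  forall eps delta : Z, (eps = 1%Z \/ eps = (-1)%Z) -> (delta = 1%Z \/ delta = (-1)%Z) ->
  Cmod (ged p eps delta) <= sqrt (INR p) + 5 / 4.
Proof.
move=> p /prime_of_Z p_pr /eqP p_odd eps delta eps1 delta1.
(* The class sums obey the sharper bound sqrt p + 1. *)
have /RleP := norm_ged p_pr p_odd eps1 delta1.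
rewrite -RplusE -R1E; Lra.lra.
Qed.
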